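(* Let $R$ be a commutative Noetherian ring with non-zero identity, let $I$ and $J$ be ideals of $R$, let $M$ be an $R$-module and let $t$ be an integer. Let $\operatorname{Supp}_R H^{i}_{I,J}(M)$ be a finite subset of $\operatorname{Max}(R)$ for all $i<t$. Then there are maximal ideals $\mathfrak m_1,\mathfrak m_2,\ldots,\mathfrak m_k\in \mathrm W(I,J)$ such that $$H^{i}_{I,J}(M)\cong H^{i}_{\mathfrak m_1}(M)\oplus H^{i}_{\mathfrak m_2}(M)\oplus\cdots\oplus H^{i}_{\mathfrak m_k}(M)$$ for all $i<t$.
   Context: $\mathrm W(I,J)$ is the set of prime ideals $\mathfrak p$ of $R$ such that $I^n\subseteq J+\mathfrak p$ for some positive integer $n$. $\Gamma_{I,J}(M)$ is the submodule of all $x\in M$ with $\operatorname{Supp}_R Rx\subseteq \mathrm W(I,J)$. This is a left exact functor, and $H^i_{I,J}(-)$ is its $i$-th right derived functor. $H^i_{\mathfrak m}(-)$ is the ordinary local cohomology functor with respect to $\mathfrak m$. $\operatorname{Max}(R)$ is the set of maximal ideals of $R$. *)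

(* Defs.v *)
From HB Require Import structures.
From mathcomp Require Import all_boot all_order all_algebra.
From mathcomp Require Import generic_quotient ring_quotient.
From mathcomp Require Import boolp classical_sets functions cardinality.

Set Implicit Arguments.
Unset Strict Implicit.
Unset Printing Implicit Defensive.

Import Order.TTheory GRing.Theory Num.Theory.
Local Open Scope classical_set_scope.
Local Open Scope ring_scope.
Local Open Scope quotient_scope.

Section Submodules.
Variables (R : comNzRingType) (M : lmodType R).

Definition is_submodule (A : M -> Prop) : Prop :=
  A 0 /\ forall (a : R) x y, A x -> A y -> A (a *: x + y).

Record submodule := Submodule {
  submodule_set :> M -> Prop;
  submoduleP : is_submodule submodule_set }.

Lemma submodule_eq (N P : submodule) :
  submodule_set N = submodule_set P -> N = P.
Proof.
case: N P => [A hA] [B hB] /= AB; subst B.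
by rewrite (Prop_irrelevance hA hB).
Qed.

Definition submodule_pred (N : submodule) : M -> bool := fun x => `[< N x >].

Lemma submodule_predP (N : submodule) : GRing.submod_closed (submodule_pred N).
Proof.
have [N0 NS] := submoduleP N; split; first exact/asboolP.
by move=> a x y /asboolP Nx /asboolP Ny; apply/asboolP/NS.
Qed.

HB.instance Definition _ N :=
  GRing.isSubmodClosed.Build R M (submodule_pred N) (submodule_predP N).

Definition submod_type (N : submodule) := {x : M | submodule_pred N x}.
HB.instance Definition _ N := SubChoice.on (submod_type N).
HB.instance Definition _ N := [SubChoice_isSubLmodule of submod_type N by <:].

Definition quot_type (N : submodule) :=
  Quotient.quot (GRing.ZmodClosed.clone M (submodule_pred N) _).
HB.instance Definition _ N := GRing.Zmodule.on (quot_type N).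
HB.instance Definition _ N := EqQuotient.on (quot_type N).

Section Quotient.
Variable N : submodule.

Definition quot_proj (x : M) : quot_type N := \pi x.

Lemma quot_projP x y : quot_proj x = quot_proj y <-> N (x - y).
Proof.
have H := Quotient.idealrBE (GRing.ZmodClosed.clone M (submodule_pred N) _) x y.
by split=> [/eqP|Nxy]; [rewrite -H => /asboolP | apply/eqP; rewrite -H; apply/asboolP].
Qed.

Lemma quot_proj_surj q : exists x, quot_proj x = q.
Proof. by exists (repr q); rewrite /quot_proj reprK. Qed.

Lemma quot_projB : zmod_morphism quot_proj.
Proof. by move=> x y; rewrite /quot_proj raddfB. Qed.

Definition quot_scale (a : R) (q : quot_type N) := quot_proj (a *: repr q).

Lemma quot_scaleE a x : quot_scale a (quot_proj x) = quot_proj (a *: x).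
Proof.
apply/quot_projP; rewrite -scalerBr -[_ *: _]addr0.
have [N0 NS] := submoduleP N; apply: NS => //; apply/quot_projP.
by rewrite /quot_proj reprK.
Qed.

Fact quot_scaleA a b q : quot_scale a (quot_scale b q) = quot_scale (a * b) q.
Proof. by have [x <-] := quot_proj_surj q; rewrite !quot_scaleE scalerA. Qed.

Fact quot_scale1 : left_id 1 quot_scale.
Proof. by move=> q; have [x <-] := quot_proj_surj q; rewrite quot_scaleE scale1r. Qed.

Let quot_projD x y : quot_proj (x + y) = quot_proj x + quot_proj y.
Proof. by rewrite /quot_proj raddfD. Qed.

Fact quot_scaleDr : right_distributive quot_scale +%R.
Proof.
move=> a p q; have [x <-] := quot_proj_surj p; have [y <-] := quot_proj_surj q.
by rewrite -quot_projD !quot_scaleE scalerDr quot_projD.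
Qed.

Fact quot_scaleDl q : {morph quot_scale^~ q : a b / a + b}.
Proof.
move=> a b; have [x <-] := quot_proj_surj q.
by rewrite !quot_scaleE scalerDl quot_projD.
Qed.

HB.instance Definition _ := GRing.Zmodule_isLmodule.Build R (quot_type N)
  quot_scaleA quot_scale1 quot_scaleDr quot_scaleDl.

Fact quot_proj_is_linear : linear quot_proj.
Proof. by move=> a x y; rewrite quot_projD -quot_scaleE. Qed.

HB.instance Definition _ :=
  GRing.isLinear.Build R M (quot_type N) _ quot_proj quot_proj_is_linear.

End Quotient.
End Submodules.

Section InjectiveResolutions.
Variable R : comNzRingType.

Definition injective_module (E : lmodType R) : Prop :=
  forall (A B : lmodType R) (f : {linear A -> B}) (g : {linear A -> E}),
    injective f -> exists h : {linear B -> E}, forall a, h (f a) = g a.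

Record injective_resolution (M : lmodType R) := InjectiveResolution {
  res_obj : nat -> lmodType R;
  res_diff : forall n, {linear res_obj n -> res_obj n.+1};
  res_aug : {linear M -> res_obj 0%N};
  res_injective : forall n, injective_module (res_obj n);
  res_aug_inj : injective res_aug;
  res_exact0 : forall x, res_diff 0 x = 0 <-> exists m, res_aug m = x;
  res_exactS : forall n x,
    res_diff n.+1 x = 0 <-> exists y, res_diff n y = x }.

End InjectiveResolutions.

(** The proof that every module has an injective resolution: the functor
    [Hom_Z(R, -)] turns powers of the divisible group [Q/Z] into injective
    modules, and every module embeds into a module of that form. *)

Section ExtendAdditive.
Variables (B D : zmodType).
Hypothesis divD : forall (d : D) (n : nat), (0 < n)%N -> exists e, e *+ n = d.

(** [G] is the graph of an additive map from a subgroup of [B] to [D]. *)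
Let good (G : set (B * D)) : Prop :=
  [/\ G 0, forall u v, G u -> G v -> G (u - v) & forall d, G (0, d) -> d = 0].

Let goodMz G u (k : int) : good G -> G u -> G (u *~ k).
Proof.
move=> [G0 GB _] Gu.
have GN v : G v -> G (- v) by move=> Gv; rewrite -sub0r; exact: GB.
have GD v w : G v -> G w -> G (v + w).
  by move=> Gv Gw; rewrite -[w]opprK; apply: (GB) => //; exact: GN.
have Gn n : G (u *+ n) by elim: n => [//|n IHn]; rewrite mulrS; exact: GD.
by case: k => n; [rewrite -pmulrn | rewrite NegzE mulrNz -pmulrn; apply: GN].
Qed.

Lemma int_subgroup_generator (P : set int) :
  P 0 -> (forall a b, P a -> P b -> P (a - b)) ->
  (forall k, P k -> k = 0) \/
  exists2 n : nat, (0 < n)%N /\ P n%:Z & forall k, P k -> exists j, k = j * n%:Z.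
Proof.
move=> P0 PB.
have PN a : P a -> P (- a) by move=> Pa; rewrite -sub0r; exact: PB.
have PD a b : P a -> P b -> P (a + b).
  by move=> Pa Pb; rewrite -[b]opprK; apply: (PB) => //; exact: PN.
have PM j n : P n -> P (j * n).
  move=> Pn; have Pk k : P (k%:Z * n).
    by elim: k => [|k IHk]; rewrite ?mul0r // -addn1 PoszD mulrDl mul1r; apply: PD.
  by case: j => k //; rewrite NegzE mulNr; apply: PN.
have [[n [n0 Pn]]|noP] := pselect (exists n : nat, (0 < n)%N /\ P n%:Z); last first.
  left=> k Pk; apply: contrapT => k0; apply: noP; exists `|k|%N.
  rewrite absz_gt0; split; first exact/eqP.
  by case: k Pk {k0} => n Pn //; rewrite NegzE in Pn *; rewrite abszN; have := PN _ Pn; rewrite opprK.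
right.
have exP : exists n, (0 < n)%N && `[< P n%:Z >].
  by exists n; rewrite n0; apply/asboolP.
case: (ex_minnP exP) => m /andP[m0 /asboolP Pm] minm.
exists m => // k Pk; exists (k %/ m)%Z.
have mZ : (m%:Z != 0) by rewrite eqz_nat -lt0n.
have Pr : P (k %% m)%Z by rewrite /modz; apply: (PB) => //; exact: PM.
have r0 : 0 <= (k %% m)%Z by exact: modz_ge0.
rewrite {1}(divz_eq k m).
suff -> : (k %% m)%Z = 0 by rewrite addr0.
have rm : (k %% m)%Z < m%:Z by rewrite ltz_pmod.
case: (k %% m)%Z r0 rm Pr => // r _ rm Pr.
case: r => [//|r] in rm Pr *.
have /minm : (0 < r.+1)%N && `[< P r.+1%:Z >] by exact/asboolP.
by rewrite leqNgt -ltz_nat rm.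
Qed.

Lemma extend_additive (G0 : set (B * D)) : good G0 ->
  exists2 h : B -> D, zmod_morphism h & forall b d, G0 (b, d) -> h b = d.
Proof.
move=> gG0.
pose P (G : set (B * D)) := good (G0 `|` G).
have [F FP totF|G [gG maxG]] := @Zorn_bigcup _ P.
  have chain u v : (G0 `|` \bigcup_(X in F) X) u -> (G0 `|` \bigcup_(X in F) X) v ->
      exists S, [/\ good S, S u, S v & S `<=` G0 `|` \bigcup_(X in F) X].
    have sub X : F X -> G0 `|` X `<=` G0 `|` \bigcup_(X in F) X.
      by move=> FX w [|Xw]; [left | right; exists X].
    move=> [Gu|[X FX Xu]] [Gv|[Y FY Yv]].
    - by exists G0; split => //; exact: subsetUl.
    - by exists (G0 `|` Y); split; [exact: FP | left | right | exact: sub].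
    - by exists (G0 `|` X); split; [exact: FP | right | left | exact: sub].
    - have [XY|YX] := totF _ _ FX FY.
        by exists (G0 `|` Y); split; [exact: FP | right; exact: XY | right | exact: sub].
      by exists (G0 `|` X); split; [exact: FP | right | right; exact: YX | exact: sub].
  split; first by left; case: gG0.
    move=> u v Uu Uv; have [S [[_ SB _] Su Sv SU]] := chain u v Uu Uv.
    by apply: SU; exact: SB.
  move=> d Ud; have [S [[_ _ S0] Sd _ _]] := chain _ _ Ud Ud.
  exact: S0.
pose H := G0 `|` G.
have [H0 HB Hf] : good H by [].
have HD u v : H u -> H v -> H (u + v).
  move=> Hu Hv; rewrite -[v]opprK; apply: (HB) => //.
  by rewrite -sub0r; exact: HB.
have Huniq b d e : H (b, d) -> H (b, e) -> d = e.
  move=> Hd He; apply/eqP; rewrite -subr_eq0; apply/eqP/Hf.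
  by have := HB _ _ Hd He; rewrite /= [X in H X](_ : _ = (0, d - e)) // -[0](subrr b).
have [tot|/existsNP[b nb]] := pselect (forall b, exists d, H (b, d)).
  have [h hP] := choice tot.
  exists h; last by move=> b d G0bd; apply: Huniq (hP b) _; left.
  by move=> x y; apply: Huniq (hP _) _; exact: HB (hP x) (hP y).
exfalso.
pose K (k : int) := exists d, H (b *~ k, d).
have [e eP] : exists e, forall k d, H (b *~ k, d) -> d = e *~ k.
  have [||K0|[n [n0 [v Hv]] Kn]] := @int_subgroup_generator K.
  - by exists 0; rewrite mulr0z.
  - move=> i j [d Hd] [e He]; exists (d - e); rewrite mulrzBr.
    exact: HB Hd He.
  - exists 0 => k d Hd; have k0 : k = 0 by apply: K0; exists d.
    by rewrite mul0rz; apply: Hf; rewrite k0 mulr0z in Hd.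
  have [e en] := divD v n0; exists e => k d Hd.
  have [j kj] := Kn k (ex_intro _ d Hd).
  apply: Huniq Hd _; rewrite kj mulrC !mulrzA -[e *~ n]pmulrn en.
  have := goodMz j gG Hv; congr H; rewrite /=.
  by rewrite [LHS]surjective_pairing !raddfMz.
pose H' : set (B * D) := [set w | exists u k, H u /\ w = u + (b *~ k, e *~ k)].
have HH' : H `<=` H'.
  move=> u Hu; exists u, 0; split => //.
  by rewrite !mulr0z addr0.
have gH' : good H'.
  split; first exact: HH'.
    move=> _ _ [u [i [Hu ->]]] [v [j [Hv ->]]]; exists (u - v), (i - j).
    split; first exact: HB.
    by rewrite !mulrzBr opprD addrACA.
  move=> d [[x y] [k [Hu [/esym/eqP]]]]; rewrite addr_eq0 => /eqP xk -> .
  have : H (b *~ (- k), y) by rewrite mulrNz -xk.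
  by move/eP => ->; rewrite mulrNz addNr.
apply: (maxG H'); last first.
  suff G0H' : G0 `<=` H' by rewrite /P (setUidr G0H').
  by move=> u Gu; apply: HH'; left.
split; first by move=> u Gu; apply: HH'; right.
move=> H'G; apply: nb; exists e; right; apply: H'G.
by exists 0, 1; split => //; rewrite !mulr1z add0r.
Qed.
End ExtendAdditive.

Definition QZ := Quotient.quot (GRing.ZmodClosed.clone rat Num.int_num_subdef _).
HB.instance Definition _ := GRing.Zmodule.on QZ.
HB.instance Definition _ := EqQuotient.on QZ.

Definition QZ_proj (x : rat) : QZ := \pi x.

Lemma QZ_projB : zmod_morphism QZ_proj.
Proof. by move=> x y; rewrite /QZ_proj raddfB. Qed.

HB.instance Definition _ := GRing.isZmodMorphism.Build rat QZ QZ_proj QZ_projB.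

Lemma QZ_proj_surj (d : QZ) : exists x, QZ_proj x = d.
Proof. by exists (repr d); rewrite /QZ_proj reprK. Qed.

Lemma QZ_proj_eq0 x : QZ_proj x = 0 <-> x \is a Num.int.
Proof.
rewrite -(raddf0 QZ_proj).
have H := Quotient.idealrBE (GRing.ZmodClosed.clone rat Num.int_num_subdef _) x 0.
rewrite subr0 in H.
by split=> [/eqP|xint]; [rewrite -H | apply/eqP; rewrite -H].
Qed.

Lemma QZ_divisible (d : QZ) (n : nat) : (0 < n)%N -> exists e, e *+ n = d.
Proof.
move=> n0; have [x <-] := QZ_proj_surj d.
exists (QZ_proj (x / n%:R)); rewrite -raddfMn -(mulr_natr (x / n%:R)).
by rewrite mulfVK ?pnatr_eq0 -?lt0n.
Qed.

Lemma QZ_separates (M : zmodType) (m : M) : m <> 0 ->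
  exists2 h : M -> QZ, zmod_morphism h & h m <> 0.
Proof.
move=> m0.
suff [q q0 qP] : exists2 q : QZ, q <> 0 & forall k : int, m *~ k = 0 -> q *~ k = 0.
  pose G : set (M * QZ) := [set w | exists k : int, w = (m *~ k, q *~ k)].
  have [|h hadd hG] := @extend_additive M QZ QZ_divisible G.
    split; first by exists 0; rewrite !mulr0z.
      by move=> _ _ [i ->] [j ->]; exists (i - j); rewrite !mulrzBr.
    by move=> d [k [/esym mk ->]]; exact: qP.
  by exists h => //; rewrite (hG m q) //; exists 1; rewrite !mulr1z.
have half (n : nat) : (1 < n)%N -> QZ_proj n%:R^-1 <> 0.
  move=> n1 /QZ_proj_eq0 /intrP [z zE].
  have : (n%:R : rat)^-1 * n%:R = 1 by rewrite mulVf // pnatr_eq0 -lt0n ltnW.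
  rewrite zE -[n%:R]/(n%:Z%:~R) -intrM => /eqP.
  rewrite -[1]/(1%:~R) eqr_int => /eqP /(congr1 absz).
  rewrite abszM /= => /eqP; rewrite muln_eq1 => /andP[_ /eqP nE].
  by rewrite nE in n1.
have [||K0|[n [n0 mn] Kn]] :=
    @int_subgroup_generator [set k : int | m *~ k = 0].
- by rewrite /= mulr0z.
- by move=> i j /= mi mj; rewrite mulrzBr mi mj subr0.
- exists (QZ_proj 2%:R^-1); first exact: half.
  by move=> k /K0 ->; rewrite mulr0z.
exists (QZ_proj n%:R^-1).
  apply: half; case: n n0 mn {Kn} => [//|[|//]] _ /=.
  by rewrite mulr1z.
have nq0 : QZ_proj n%:R^-1 *+ n = 0.
  rewrite -raddfMn; apply/QZ_proj_eq0.
  by rewrite -(mulr_natr n%:R^-1) mulVf ?pnatr_eq0 -?lt0n.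
by move=> k /Kn [j ->]; rewrite mulrC mulrzA -pmulrn nq0 mul0rz.
Qed.

Lemma zmod_morphismD (A B : zmodType) (h : A -> B) :
  zmod_morphism h -> {morph h : x y / x + y}.
Proof.
move=> hB x y; have h0 : h 0 = 0 by rewrite -(subrr 0) hB subrr.
by rewrite -{1}[y]opprK hB -[- y]sub0r hB h0 sub0r opprK.
Qed.

Section Coinduced.
Variables (R : comNzRingType) (D : zmodType).

(** [Hom_Z(R, D)], on which [a : R] acts by [(a phi) r = phi (r a)]. *)
Definition coind_pred : (R -> D) -> bool := fun phi => `[< zmod_morphism phi >].

Fact coind_zmod_closed : zmod_closed coind_pred.
Proof.
split; first by apply/asboolP => x y; rewrite /= subr0.
move=> f g /asboolP fB /asboolP gB; apply/asboolP => x y.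
rewrite -[LHS]/(f (x - y) - g (x - y)) -[RHS]/((f x - g x) - (f y - g y)).
by rewrite fB gB !opprD addrACA.
Qed.
HB.instance Definition _ :=
  GRing.isZmodClosed.Build (R -> D) coind_pred coind_zmod_closed.

Definition coind := {phi : R -> D | coind_pred phi}.
HB.instance Definition _ := SubChoice.on coind.
HB.instance Definition _ := [SubChoice_isSubZmodule of coind by <:].

Lemma coindP (phi : coind) : zmod_morphism (val phi).
Proof. exact/asboolP/(valP phi). Qed.

Definition coind_mk (phi : R -> D) (phiB : zmod_morphism phi) : coind :=
  Sub phi (introT (asboolP _) phiB).

Lemma coind_eq (phi psi : coind) : (forall r, val phi r = val psi r) -> phi = psi.
Proof. by move=> e; apply/val_inj/funext. Qed.

Fact coind_scale_subproof (a : R) (phi : coind) :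
  zmod_morphism (fun r => val phi (r * a)).
Proof. by move=> x y; rewrite mulrBl coindP. Qed.

Definition coind_scale a phi := coind_mk (coind_scale_subproof a phi).

Fact coind_scaleA a b phi :
  coind_scale a (coind_scale b phi) = coind_scale (a * b) phi.
Proof. by apply: coind_eq => r /=; rewrite -mulrA. Qed.
Fact coind_scale1 : left_id 1 coind_scale.
Proof. by move=> phi; apply: coind_eq => r /=; rewrite mulr1. Qed.
Fact coind_scaleDr : right_distributive coind_scale +%R.
Proof. by move=> a phi psi; apply: coind_eq. Qed.
Fact coind_scaleDl phi : {morph coind_scale^~ phi : a b / a + b}.
Proof.
move=> a b; apply: coind_eq => r.
by rewrite -[LHS]/(val phi (r * (a + b))) mulrDr (zmod_morphismD (coindP phi)).
Qed.
HB.instance Definition _ := GRing.Zmodule_isLmodule.Build R coind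
  coind_scaleA coind_scale1 coind_scaleDr coind_scaleDl.

Lemma coind_injective :
  (forall (d : D) n, (0 < n)%N -> exists e, e *+ n = d) ->
  injective_module (coind : lmodType R).
Proof.
move=> divD A B f g finj.
pose G : set (B * D) := [set w | exists a, w = (f a, val (g a) 1)].
have [|h hB hG] := @extend_additive B D divD G.
  split; first by exists 0; rewrite !raddf0.
    by move=> _ _ [a ->] [a' ->]; exists (a - a'); rewrite !raddfB.
  move=> d [a [/esym fa0 ->]].
  have -> : a = 0 by apply: finj; rewrite fa0 raddf0.
  by rewrite raddf0.
have hbB b : zmod_morphism (fun r : R => h (r *: b)).
  by move=> x y; rewrite scalerBl hB.
pose H b := coind_mk (hbB b).
have Hlin : linear H.
  move=> a x y; apply: coind_eq => r /=.
  by rewrite scalerDr (zmod_morphismD hB) scalerA.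
pose HL := GRing.isLinear.Build R B coind _ H Hlin.
exists (HB.pack_for {linear B -> coind} H HL) => a /=.
apply: coind_eq => r /=; rewrite -linearZ (hG _ (val (g (r *: a)) 1)); last by exists (r *: a).
by rewrite linearZ /= mul1r.
Qed.

End Coinduced.
Section StandardResolution.
Variable R : comNzRingType.

Section Hull.
Variable M : lmodType R.

(** The power of [Q/Z] has one factor for every function [h : M -> Q/Z]; the
    factors at the non-additive [h] are superfluous but harmless. *)
Definition hull : lmodType R := coind R ((M -> QZ) -> QZ).

Lemma hull_injective : injective_module hull.
Proof.
apply: coind_injective => d n n0.
have /choice[e eP] : forall f, exists e, e *+ n = d f.
  by move=> f; exact: QZ_divisible.
exists e; apply/funext => f; rewrite -eP.
by elim: n {n0 eP} => // n IHn; rewrite !mulrS -IHn.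
Qed.

Fact hull_emb_subproof (m : M) : zmod_morphism (fun (r : R) (h : M -> QZ) =>
  if `[< zmod_morphism h >] then h (r *: m) else 0).
Proof.
move=> x y; apply/funext => h.
rewrite -[RHS]/((if _ then _ else _) - (if _ then _ else _)).
by case: ifPn => [/asboolP hB|_]; rewrite ?subr0 // scalerBl hB.
Qed.

Definition hull_emb (m : M) : hull := coind_mk (hull_emb_subproof m).

Fact hull_emb_is_linear : linear hull_emb.
Proof.
move=> a x y; apply: coind_eq => r; apply/funext => h.
rewrite -[RHS]/((if _ then h ((r * a) *: x) else _) + (if _ then _ else _)).
rewrite -[LHS]/(if _ then _ else _).
case: ifPn => [/asboolP hB|_]; rewrite ?addr0 //.
by rewrite scalerDr (zmod_morphismD hB) scalerA.
Qed.

HB.instance Definition _ :=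
  GRing.isLinear.Build R M hull _ hull_emb hull_emb_is_linear.

Lemma hull_emb_eq0 m : hull_emb m = 0 -> m = 0.
Proof.
move=> e0; apply: contrapT => /QZ_separates[h hB]; apply.
have := congr1 (fun phi : hull => val phi 1 h) e0.
rewrite -[RHS]/0 -[LHS]/(if _ then h (1 *: m) else 0) scale1r.
by rewrite (introT (asboolP _) hB).
Qed.

Lemma hull_emb_inj : injective hull_emb.
Proof.
move=> x y /eqP; rewrite -subr_eq0 -raddfB => /eqP /hull_emb_eq0 /eqP.
by rewrite subr_eq0 => /eqP.
Qed.

Fact hull_image_subproof : is_submodule (range hull_emb : set hull).
Proof.
split; first by exists 0; rewrite ?raddf0.
by move=> a _ _ [x _ <-] [y _ <-]; exists (a *: x + y); rewrite ?linearP.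
Qed.

Definition cosyzygy : lmodType R := quot_type (Submodule hull_image_subproof).
Definition hull_coker : {linear hull -> cosyzygy} := @quot_proj R hull _.

Lemma hull_coker_eq0 x : hull_coker x = 0 <-> exists m, hull_emb m = x.
Proof.
rewrite -(raddf0 hull_coker); split.
  by move=> /quot_projP [m _]; rewrite subr0 => <-; exists m.
by move=> [m <-]; apply/quot_projP; rewrite subr0; exists m.
Qed.
End Hull.

Definition cosyzygies (M : lmodType R) (n : nat) : lmodType R := iter n cosyzygy M.

Definition standard_resolution (M : lmodType R) : injective_resolution M.
Proof.
pose d n : {linear hull (cosyzygies M n) -> hull (cosyzygies M n.+1)} :=
  @hull_emb (cosyzygies M n.+1) \o hull_coker (cosyzygies M n).
have dE n x : d n x = 0 <-> exists m, @hull_emb (cosyzygies M n) m = x.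
  rewrite -hull_coker_eq0; split=> [/hull_emb_eq0 //|/= ->].
  exact: raddf0.
apply: (@InjectiveResolution R M (fun n => hull (cosyzygies M n)) d (@hull_emb M)).
- by move=> n; exact: hull_injective.
- exact: hull_emb_inj.
- exact: dE.
move=> n x; rewrite dE; split=> [[q <-]|[y <-]]; last by exists (hull_coker _ y).
by have [y <-] := quot_proj_surj q; exists y.
Defined.

End StandardResolution.
Section DerivedFunctors.
Variable R : comNzRingType.

Definition isomorphic (M N : lmodType R) : Prop :=
  exists f : {linear M -> N}, bijective f.

(** Linear maps are bundled, so the laws are stated for every bundled map that
    is pointwise the identity, a composite or a sum. *)
Record additive_functor := AdditiveFunctor {
  fobj :> lmodType R -> lmodType R;
  fmap : forall M N : lmodType R, {linear M -> N} -> {linear fobj M -> fobj N};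
  fmap_id : forall (M : lmodType R) (f : {linear M -> M}),
    (forall x, f x = x) -> forall y, fmap f y = y;
  fmap_comp : forall (M N P : lmodType R) (f : {linear M -> N})
      (g : {linear N -> P}) (h : {linear M -> P}),
    (forall x, h x = g (f x)) -> forall y, fmap h y = fmap g (fmap f y);
  fmap_add : forall (M N : lmodType R) (f g h : {linear M -> N}),
    (forall x, h x = f x + g x) -> forall y, fmap h y = fmap f y + fmap g y }.

Section Cohomology.
Variables (C : nat -> lmodType R) (d : forall n, {linear C n -> C n.+1}).

Fact cocycle_subproof n : is_submodule (fun x => d n x = 0).
Proof.
split; first exact: raddf0.
by move=> a x y dx dy; rewrite linearP dx dy scaler0 addr0.
Qed.
Definition cocycle n := Submodule (@cocycle_subproof n).

Definition is_coboundary (n : nat) : C n -> Prop :=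
  match n with
  | 0 => fun x => x = 0
  | n'.+1 => fun x => exists y, d n' y = x
  end.

Fact coboundary_subproof n :
  is_submodule (fun z : submod_type (cocycle n) => is_coboundary (val z)).
Proof.
case: n => [|n]; split => //.
- move=> a x y x0 y0; rewrite /= -[LHS]/(a *: val x + val y).
  by rewrite [val x]x0 [val y]y0 scaler0 addr0.
- by exists 0; rewrite raddf0.
- by move=> a x y [u du] [v dv]; exists (a *: u + v); rewrite linearP du dv.
Qed.
(** The coboundaries that are cocycles, as a submodule of the cocycles; nothing
    is lost when [d n.+1 \o d n = 0]. *)
Definition coboundary n := Submodule (@coboundary_subproof n).

Definition cohomology n : lmodType R := quot_type (coboundary n).
End Cohomology.

(** Computed on one fixed injective resolution of [M]: another choice gives an
    isomorphic module. *)
Definition right_derived (F : additive_functor) (i : nat) (M : lmodType R) :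
    lmodType R :=
  let E := standard_resolution M in
  cohomology (fun n => fmap F (res_diff E n)) i.

(** A submodule [G M] of each [M], preserved by all linear maps, is a subfunctor
    of the identity; a linear map [f : M -> N] acts by restriction. *)
Section Subfunctor.
Variable G : forall M : lmodType R, submodule M.
Hypothesis G_natural :
  forall (M N : lmodType R) (f : {linear M -> N}) x, G M x -> G N (f x).

Let Gobj (M : lmodType R) : lmodType R := submod_type (G M).

Section Map.
Variables (M N : lmodType R) (f : {linear M -> N}).

Fact subfunctor_map_subproof (x : Gobj M) : submodule_pred (G N) (f (val x)).
Proof. by apply/asboolP/G_natural/asboolP; exact: (valP x). Qed.

Definition subfunctor_map (x : Gobj M) : Gobj N :=
  Sub (f (val x)) (subfunctor_map_subproof x).

Fact subfunctor_map_is_linear : linear subfunctor_map.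
Proof. by move=> a x y; apply: val_inj; rewrite /= !linearP. Qed.

HB.instance Definition _ := GRing.isLinear.Build R (Gobj M) (Gobj N) _
  subfunctor_map subfunctor_map_is_linear.
End Map.

Definition subfunctor : additive_functor.
Proof.
refine (@AdditiveFunctor Gobj
  (fun M N f => @subfunctor_map M N f : {linear _ -> _}) _ _ _).
- by move=> M f fE y; apply: val_inj; exact: fE.
- by move=> M N P f g h hE y; apply: val_inj; exact: hE.
- by move=> M N f g h hE y; apply: val_inj; exact: hE.
Defined.

End Subfunctor.

Fixpoint direct_sum (s : seq (lmodType R)) : lmodType R :=
  if s is N :: s' then (N * direct_sum s')%type : lmodType R else 'rV[R]_0.

End DerivedFunctors.

(** Not [idealr] of ring_quotient, which excludes the unit ideal. *)
Notation ideal R := (submodule R^o).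

Section LocalCohomology.
Variable R : comNzRingType.
Implicit Types (I J p m : ideal R) (M N : lmodType R).

Definition noetherian : Prop :=
  forall I, exists (n : nat) (g : 'I_n -> R), forall x : R,
    I x <-> exists c : 'I_n -> R, x = \sum_(i < n) c i * g i.

Definition prime_ideal p : Prop :=
  ~ p (1 : R) /\ forall a b : R, p (a * b) -> p a \/ p b.

Definition maximal_ideal m : Prop :=
  ~ m (1 : R) /\
  forall I, (forall x : R, m x -> I x) -> I (1 : R) \/ forall x : R, I x -> m x.

Definition Max : set (ideal R) := [set m | maximal_ideal m].

Definition ideal_sum (A B : set R) : set R :=
  [set x | exists a b, [/\ A a, B b & x = a + b]].

Definition ideal_prod (A B : set R) : set R :=
  [set x | exists (n : nat) (a b : 'I_n -> R),
    (forall i, A (a i) /\ B (b i)) /\ x = \sum_(i < n) a i * b i].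

Fixpoint ideal_exp (A : set R) (n : nat) : set R :=
  if n is n'.+1 then ideal_prod A (ideal_exp A n') else setT.

(** Equality of the fractions [x / s] and [y / u] in the localization [M_p],
    where [s] and [u] lie outside [p]. *)
Definition frac_eq p M (x : M) (s : R) (y : M) (u : R) : Prop :=
  exists v : R, ~ p v /\ v *: (u *: x - s *: y) = 0.

(** The primes [p] such that [M_p <> 0]. *)
Definition Supp M : set (ideal R) :=
  [set p | prime_ideal p /\
    exists (x : M) (s : R), ~ p s /\ ~ frac_eq p x s 0 1].

Fact cyclic_subproof M (x : M) : is_submodule (fun y => exists a : R, y = a *: x).
Proof.
split; first by exists 0; rewrite scale0r.
by move=> a _ _ [b ->] [c ->]; exists (a * b + c); rewrite scalerDl scalerA.
Qed.
Definition cyclic M (x : M) := Submodule (cyclic_subproof x).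

Definition W I J : set (ideal R) :=
  [set p | prime_ideal p /\
    exists n : nat, (0 < n)%N /\ ideal_exp I n `<=` ideal_sum J p].

Lemma Supp_cyclicP M (x : M) p : Supp (submod_type (cyclic x)) p <->
  prime_ideal p /\ forall v : R, v *: x = 0 -> p v.
Proof.
split=> [[pp [y [s [ps ny]]]]|[[p1 pM] px]].
  split=> // v vx; apply: contrapT => pv; apply: ny; exists v; split=> //.
  rewrite scale1r scaler0 subr0; apply: val_inj; rewrite linearZ /=.
  have /asboolP[a ->] := valP y.
  by rewrite scalerA mulrC -scalerA vx scaler0.
have xP : submodule_pred (cyclic x) x by apply/asboolP; exists 1; rewrite scale1r.
split=> //; exists (Sub x xP), 1; split=> //.
move=> [v [pv]]; rewrite scale1r scaler0 subr0 => /(congr1 val) vx.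
by apply/pv/px; exact: vx.
Qed.

Fact Gamma_pair_subproof I J M :
  is_submodule (fun x : M => Supp (submod_type (cyclic x)) `<=` W I J).
Proof.
split=> [p /Supp_cyclicP[[p1 _] p0]|a x y xW yW p /Supp_cyclicP[pp pz]].
  by case: p1; apply: p0; rewrite scaler0.
have [px|] := pselect (forall v : R, v *: x = 0 -> p v).
  by apply: xW; apply/Supp_cyclicP.
move=> /existsNP[u /not_implyP[ux pu]].
apply: yW; apply/Supp_cyclicP; split=> // v vy.
have [||//] := pp.2 u v; last by move=> /pu.
apply: pz; rewrite scalerDr -[X in _ + X]scalerA vy scaler0 addr0.
by rewrite mulrC -scalerA [u *: (a *: x)]scalerA mulrC -scalerA ux !scaler0.
Qed.
Definition Gamma_pair_set I J M := Submodule (@Gamma_pair_subproof I J M).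

Fact Gamma_pair_natural I J M N (f : {linear M -> N}) x :
  Gamma_pair_set I J M x -> Gamma_pair_set I J N (f x).
Proof.
move=> xW p /Supp_cyclicP[pp pfx]; apply: xW; apply/Supp_cyclicP; split=> // v vx.
by apply: pfx; rewrite -linearZ vx linear0.
Qed.

Definition Gamma_pair I J : additive_functor R :=
  subfunctor (@Gamma_pair_natural I J).

Lemma ideal_exp_mul A n (a x : R) : ideal_exp A n x -> ideal_exp A n (a * x).
Proof.
elim: n a x => [//|n IHn] a x [k [b [c [bc ->]]]].
exists k, b, (fun i => a * c i); split.
  by move=> i; have [? ?] := bc i; split=> //; exact: IHn.
by rewrite mulr_sumr; apply: eq_bigr => i _; rewrite mulrCA.
Qed.

Lemma ideal_expS A n : ideal_exp A n.+1 `<=` ideal_exp A n.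
Proof.
elim: n => [//|n IHn] _ [k [b [c [bc ->]]]].
by exists k, b, c; split=> // i; have [? ?] := bc i; split=> //; exact: IHn.
Qed.

Lemma ideal_exp_le A n k : (n <= k)%N -> ideal_exp A k `<=` ideal_exp A n.
Proof.
move=> /subnK <-; elim: (k - n)%N => [//|j IHj].
by apply: subset_trans IHj; exact: ideal_expS.
Qed.

Fact Gamma_subproof I M : is_submodule
  (fun x : M => exists n : nat, forall a, ideal_exp I n a -> a *: x = 0).
Proof.
split; first by exists 0%N => a _; rewrite scaler0.
move=> a x y [n nx] [k ky]; exists (maxn n k) => b Ib.
rewrite scalerDr ky ?addr0; last exact: ideal_exp_le (leq_maxr _ _) _ Ib.
rewrite scalerA mulrC -scalerA nx ?scaler0 //.
exact: ideal_exp_le (leq_maxl _ _) _ Ib.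
Qed.
Definition Gamma_set I M := Submodule (@Gamma_subproof I M).

Fact Gamma_natural I M N (f : {linear M -> N}) x :
  Gamma_set I M x -> Gamma_set I N (f x).
Proof. by move=> [n nx]; exists n => a /nx ax; rewrite -linearZ ax linear0. Qed.

Definition Gamma I : additive_functor R := subfunctor (@Gamma_natural I).

Definition local_cohomology_pair I J (i : nat) M : lmodType R :=
  right_derived (Gamma_pair I J) i M.

Definition local_cohomology I (i : nat) M : lmodType R :=
  right_derived (Gamma I) i M.

End LocalCohomology.

Arguments Max : clear implicits.

(* Main.v *)
(** Call [x] torsion for a set [A] of primes if every prime containing the annihilator
    of [x] lies in [A]; so [Gamma_pair I J] is torsion for [W I J], and for a maximal
    ideal [m], [Gamma m] is torsion for [{m}].  Over a Noetherian ring an essential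
    extension of an [A]-torsion module is [A]-torsion, hence the [A]-torsion of an
    injective module is a direct summand.  Let [S] be the finite union of the supports
    of the [H^i_{I,J}(M)], [i < t]; it is contained in [W I J].  In an injective
    resolution [E], the [W]-torsion modulo the [S]-torsion is a complex of injective
    modules without [S]-torsion; its cohomology below [t] is [S]-torsion, so that
    complex is null-homotopic below [t] and [H^i_{I,J}(M)] is the cohomology of the
    [S]-torsion of [E].  As [S] consists of maximal ideals, [S]-torsion splits as the
    direct sum of the [{m}]-torsions, [m] in [S]. *)
From HB Require Import structures.
Require Import Defs.
From mathcomp Require Import all_boot all_order all_algebra.
From mathcomp Require Import boolp classical_sets functions cardinality.
From mathcomp Require Import ring.

Set Implicit Arguments.
Unset Strict Implicit.
Unset Printing Implicit Defensive.

Import Order.TTheory GRing.Theory Num.Theory.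
Local Open Scope classical_set_scope.
Local Open Scope ring_scope.

(** * Submodules and prime ideals obtained from Zorn's lemma *)

Section Submodules.
Variable R : comNzRingType.
Implicit Types (M : lmodType R).

Lemma submodule0 M (N : submodule M) : N 0.
Proof. exact: (submoduleP N).1. Qed.

Lemma submoduleS M (N : submodule M) a x y : N x -> N y -> N (a *: x + y).
Proof. exact: (submoduleP N).2. Qed.

Lemma submoduleZ M (N : submodule M) a x : N x -> N (a *: x).
Proof. by move=> Nx; rewrite -[_ *: _]addr0; apply/submoduleS/submodule0. Qed.

Lemma submoduleD M (N : submodule M) x y : N x -> N y -> N (x + y).
Proof. by move=> Nx Ny; rewrite -[x]scale1r; apply: submoduleS. Qed.

Lemma submoduleB M (N : submodule M) x y : N x -> N y -> N (x - y).
Proof. by move=> Nx Ny; rewrite addrC -scaleN1r; apply: submoduleS. Qed.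

Lemma ideal_mull (I : ideal R) (a x : R) : I x -> I (a * x).
Proof. exact: (@submoduleZ R^o). Qed.

Lemma ideal_add (I : ideal R) (x y : R) : I x -> I y -> I (x + y).
Proof. exact: (@submoduleD R^o). Qed.

(** Used twice: a multiplicative set [U] yields primes, and the set [U] of nonzero torsion elements
    yields an essential extension. *)
Lemma maximal_avoiding M (N : submodule M) (U : set M) :
  (forall x, N x -> ~ U x) ->
  exists P : submodule M, [/\ forall x, N x -> P x, forall x, P x -> ~ U x &
    forall x, ~ P x -> exists p r, P p /\ U (p + r *: x)].
Proof.
move=> NU.
(* The empty chain has empty union, so the empty set must be [good]: only nonempty sets are asked to
   contain [N]. *)
pose good (X : set M) := [/\ forall a x y, X x -> X y -> X (a *: x + y),
  forall x, X x -> forall z, N z -> X z & forall x, X x -> ~ U x].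
have [F FP totF|G [[GS GN GU] maxG]] := @Zorn_bigcup _ good.
  split.
  - move=> a x y [X FX Xx] [Y FY Yy].
    have [XY|YX] := totF _ _ FX FY.
      by exists Y => //; have [YS _ _] := FP _ FY; apply: YS => //; apply: XY.
    by exists X => //; have [XS _ _] := FP _ FX; apply: XS => //; apply: YX.
  - by move=> x [X FX Xx] z Nz; exists X => //; have [_ XN _] := FP _ FX; apply: XN Xx _ Nz.
  - by move=> x [X FX Xx]; have [_ _] := FP _ FX; apply.
have [[g Gg]|G0] := pselect (exists g, G g); last first.
  case: (maxG N).
    split=> [x Gx|NG]; first by case: G0; exists x.
    by apply: G0; exists 0; apply: NG; exact: submodule0.
  split=> //; first by move=> a x y Nx Ny; exact: submoduleS.
have GP : is_submodule G by split=> //; apply: GN Gg _ (submodule0 N).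
exists (Submodule GP); split=> [z Nz|//|x nGx]; first exact: GN Gg z Nz.
pose H := [set z | exists p r, G p /\ z = p + r *: x].
have GH : G `<=` H by move=> z Gz; exists z, 0; rewrite scale0r addr0.
apply: contrapT => noU; apply: (maxG H).
  split=> // HG; apply: nGx; apply: HG; exists 0, 1.
  by rewrite add0r scale1r; split=> //; exact: GP.1.
split.
- move=> a _ _ [p [r [Gp ->]]] [p' [r' [Gp' ->]]].
  exists (a *: p + p'), (a * r + r'); split; first exact: GS.
  by rewrite scalerDr scalerDl scalerA addrACA.
- by move=> _ _ z Nz; apply/GH/(GN _ Gg).
- by move=> _ [p [r [Gp ->]]] Upr; apply: noU; exists p, r.
Qed.

(** An ideal maximal among those avoiding a multiplicative set is prime: for [x], [y] outside it,
    some [p + r * x] and [p' + r' * y] lie in [U], and their product would lie in the ideal if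
    [x * y] did. *)
Lemma prime_avoiding (b : ideal R) (U : set R) : U 1 ->
  (forall x y, U x -> U y -> U (x * y)) -> (forall x, b x -> ~ U x) ->
  exists q : ideal R, [/\ prime_ideal q, forall x : R, b x -> q x &
    forall x : R, q x -> ~ U x].
Proof.
move=> U1 UM bU; have [P [bP PU maxP]] := @maximal_avoiding R^o b U bU.
exists P; split=> //; split; first by move/PU; apply.
move=> x y Pxy; apply: contrapT => /not_orP[/maxP[p [r [Pp Up]]] /maxP[p' [r' [Pp' Up']]]].
have PM (c d : R) : P c -> P d -> P ((c + r * x) * (d + r' * y)).
  move=> Pa Pb; rewrite mulrDr; apply: ideal_add; first exact: ideal_mull.
  rewrite mulrDl; apply: ideal_add; first by rewrite mulrC; exact: ideal_mull.
  by rewrite mulrACA; exact: ideal_mull.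
exact: PU (PM _ _ Pp Pp') (UM _ _ Up Up').
Qed.

Fact annihilator_subproof M (x : M) : is_submodule (fun r : R^o => r *: x = 0).
Proof.
split; first by rewrite scale0r.
by move=> a r s rx sx; rewrite scalerDl sx addr0 -[a *: r]/(a * r) -scalerA rx scaler0.
Qed.
Definition annihilator M (x : M) : ideal R := Submodule (annihilator_subproof x).

Lemma prime_mul (q : ideal R) (a b : R) : prime_ideal q -> ~ q a -> ~ q b -> ~ q (a * b).
Proof. by move=> [_ qM] qa qb /qM[]. Qed.

Lemma prime_exp (q : ideal R) (a : R) n : prime_ideal q -> q (a ^+ n) -> q a.
Proof.
move=> [q1 qM]; elim: n => [/q1 //|n IHn]; rewrite exprS => /qM[//|]; exact: IHn.
Qed.

(** * Torsion with respect to a set of primes *)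

Section Torsion.
Variable A : set (ideal R).

Fact torsion_subproof M : is_submodule (fun x : M =>
  forall q : ideal R, prime_ideal q -> (forall v : R, v *: x = 0 -> q v) -> A q).
Proof.
split=> [q [q1 _] q0|a x y Tx Ty q qp qz]; first by case: q1; apply: q0; rewrite scaler0.
have [qx|] := pselect (forall v : R, v *: x = 0 -> q v); first exact: Tx.
move=> /existsNP[u /not_implyP[ux qu]].
apply: Ty => // v vy; have [||//] := qp.2 u v; last by move=> /qu.
apply: qz; rewrite scalerDr -[X in _ + X]scalerA vy scaler0 addr0.
by rewrite mulrC -scalerA [u *: (a *: x)]scalerA mulrC -scalerA ux !scaler0.
Qed.
Definition torsion M := Submodule (@torsion_subproof M).

Lemma torsion_natural M (N : lmodType R) (f : {linear M -> N}) x :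
  torsion M x -> torsion N (f x).
Proof.
move=> Tx q qp qfx; apply: Tx => // v vx.
by apply: qfx; rewrite -linearZ vx linear0.
Qed.

(** [x] is [A]-torsion iff it vanishes in [M_q] for each prime [q] outside [A]. *)
Lemma torsionP M (x : M) : torsion M x <->
  forall q : ideal R, prime_ideal q -> ~ A q -> exists2 u : R, ~ q u & u *: x = 0.
Proof.
split=> [Tx q qp qA|Tx q qp qx].
  apply: contrapT => nu; apply: qA; apply: Tx => // v vx.
  by apply: contrapT => qv; apply: nu; exists v.
by apply: contrapT => /(Tx q qp)[u qu /qx].
Qed.

Lemma torsion_local M (x : M) :
  (forall q : ideal R, prime_ideal q -> ~ A q -> exists2 u : R, ~ q u & torsion M (u *: x)) ->
  torsion M x.
Proof.
move=> Tx; apply/torsionP => q qp qA.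
have [u qu /torsionP/(_ q qp qA)[v qv vux]] := Tx q qp qA.
by exists (v * u); [exact: prime_mul | rewrite -scalerA].
Qed.
End Torsion.

Lemma torsion_mono (A B : set (ideal R)) M (x : M) :
  A `<=` B -> torsion A M x -> torsion B M x.
Proof. by move=> AB Tx q qp qx; apply/AB/Tx. Qed.

Lemma ideal_unit (b : ideal R) : (forall q : ideal R, prime_ideal q ->
  ~ (forall x : R, b x -> q x)) -> b (1 : R).
Proof.
move=> nq; apply: contrapT => b1.
have [||x bx x1|q [qp bq _]] := @prime_avoiding b [set 1].
- by [].
- by move=> x y /= -> ->; rewrite mulr1.
- by apply: b1; rewrite -x1.
- exact: nq bq.
Qed.

Lemma torsion0 M (x : M) : torsion set0 M x -> x = 0.
Proof.
move=> Tx; rewrite -[x]scale1r; apply: (@ideal_unit (annihilator x)) => q qp qx.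
by case: (Tx q qp).
Qed.

Lemma torsion_disjoint (A B : set (ideal R)) M (x : M) :
  A `&` B `<=` set0 -> torsion A M x -> torsion B M x -> x = 0.
Proof.
move=> AB TA TB; apply: torsion0 => q qp qx; apply: AB.
by split; [apply: TA | apply: TB].
Qed.

End Submodules.

(** * Torsion over a Noetherian ring *)

Section Noetherian.
Variable R : comNzRingType.
Hypothesis noethR : noetherian R.
Implicit Types M : lmodType R.

(** The [r] for which [r *: x] vanishes in the localization at [q] form an ideal; [s] is the product
    of denominators for its finitely many generators. Thus the multiples of [s *: x] embed in the
    localization. *)
Lemma uniform_denominator M (q : ideal R) (x : M) : prime_ideal q ->
  exists2 s : R, ~ q s & forall u r : R, ~ q u -> (u * r) *: x = 0 -> (s * r) *: x = 0.
Proof.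
move=> qp.
have bP : is_submodule (fun r : R^o => exists2 u : R, ~ q u & (u * r) *: x = 0).
  split; first by exists 1; [case: qp | rewrite mulr0 scale0r].
  move=> a r r' [u qu ux] [v qv vx]; exists (u * v); first exact: prime_mul.
  have -> : u * v * (a * r + r') = v * a * (u * r) + u * (v * r') by ring.
  by rewrite scalerDl -!(scalerA _ (_ * _)) ux vx !scaler0 addr0.
have [n [g gP]] := noethR (Submodule bP).
have /choice[u uP] : forall i, exists u : R, ~ q u /\ (u * g i) *: x = 0.
  move=> i; have /gP[v qv vx] : exists c : 'I_n -> R, g i = \sum_(j < n) c j * g j.
    exists (fun j => (i == j)%:R); rewrite (bigD1 i) //= eqxx mul1r big1 ?addr0 //.
    by move=> j; rewrite eq_sym => /negPf ->; rewrite mul0r.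
  by exists v.
exists (\prod_(i < n) u i).
  elim/big_ind: _ => [||i _]; first by case: qp.
    by move=> a b qa qb; exact: prime_mul.
  exact: (uP i).1.
move=> v r qv vr; have /gP[c ->] : Submodule bP r by exists v.
rewrite mulr_sumr scaler_suml big1 // => i _.
rewrite (bigD1 i) //=; set w := \prod_(j < n | _) _.
have -> : u i * w * (c i * g i) = w * c i * (u i * g i) by ring.
by rewrite -scalerA (uP i).2 scaler0.
Qed.

(** An essential extension of a torsion module is torsion, for cyclic modules. *)
Lemma torsion_essential (A : set (ideal R)) M (x : M) :
  (forall r : R, r *: x <> 0 ->
    exists s : R, (s * r) *: x <> 0 /\ torsion A M ((s * r) *: x)) ->
  torsion A M x.
Proof.
(* As [s] is outside [q], [s *: x] has a nonzero torsion multiple, whose annihilator lies in [q] by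
   the choice of [s]. *)
move=> ess q qp qx; have [s qs sP] := uniform_denominator x qp.
have [|r [rsx Tr]] := ess s; first by move/qx.
apply: Tr => // v vrsx; apply: contrapT => qv; apply: rsx.
rewrite mulrC; apply: (sP (v * s)); first exact: prime_mul.
by rewrite -mulrA [s * r]mulrC -scalerA.
Qed.

(** For [P] maximal among the submodules without nonzero torsion, the torsion of [E] embeds in
    [E / P] as an essential submodule. So extending its inclusion in [E] to a map [h] on [E / P]
    keeps the image torsion. *)
Lemma torsion_retraction (A : set (ideal R)) (E : lmodType R) : injective_module E ->
  exists pi : {linear E -> E},
    (forall x, torsion A E (pi x)) /\ forall x, torsion A E x -> pi x = x.
Proof.
move=> injE; pose T := torsion A E.
have z_sub : is_submodule (fun x : E => x = 0).
  by split=> // a x y -> ->; rewrite scaler0 addr0.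
have [|P [_ PT maxP]] := @maximal_avoiding R E (Submodule z_sub) [set x | x <> 0 /\ T x].
  by move=> x -> [].
pose pr : {linear E -> Defs.quot_type P} := quot_proj P.
pose f : {linear submod_type T -> Defs.quot_type P} := pr \o val.
have finj : injective f.
  move=> x y /quot_projP Pxy; apply: val_inj; apply/eqP; rewrite -subr_eq0; apply/eqP.
  apply: contrapT => xy; apply: (PT _ Pxy); split=> //.
  by apply: submoduleB; apply/asboolP; [exact: (valP x) | exact: (valP y)].
have [h hP] := injE _ _ f (val : {linear submod_type T -> E}) finj.
have hT x (Tx : T x) : h (pr x) = x.
  by rewrite -[RHS](hP (Sub x (introT (asboolP _) Tx))).
exists (h \o pr); split=> // x.
apply: torsion_essential => r rx.
have nP : ~ P (r *: x).
  move=> Prx; apply: rx; rewrite /= -linearZ -[LHS]/(h (r *: pr x)) -linearZ /=.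
  suff -> : quot_proj P (r *: x) = 0 by rewrite linear0.
  by rewrite -(raddf0 pr); apply/quot_projP; rewrite subr0.
have [p [s [Pp [psx Tpsx]]]] := maxP _ nP.
exists s; suff -> : (s * r) *: (h \o pr) x = p + s *: (r *: x) by [].
rewrite -[RHS]hT // /= -linearZ; congr (h _).
by rewrite -linearZ; apply/quot_projP; rewrite scalerA opprD addrCA subrr addr0
  -[- p]sub0r; apply/submoduleB => //; exact: submodule0.
Qed.

(** If a prime [q] contains the annihilator of [s *: x], for [s] the uniform denominator at [p],
    then some prime inside both [p] and [q] contains the annihilator of [x]. It is in [S], hence
    maximal, and equals both. *)
Lemma torsion_localize (S : set (ideal R)) M (x : M) (p : ideal R) :
  S `<=` Max R -> prime_ideal p -> torsion S M x -> S p ->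
  exists2 s : R, ~ p s & torsion [set p] M (s *: x).
Proof.
move=> SMax pp Tx Sp; have [s ps sP] := uniform_denominator x pp.
exists s => // q qp qsx.
have Sq : S q by apply: Tx => // v vx; apply: qsx; rewrite scalerA mulrC -scalerA vx scaler0.
apply: contrapT => qNp.
pose U := [set r : R | exists u v, [/\ ~ q u, ~ p v & r = u * v]].
have [||r rx [u [v [qu pv ruv]]]|k [kp kx kU]] := @prime_avoiding R (annihilator x) U.
- by exists 1, 1; rewrite mulr1; split=> //; [case: qp | case: pp].
- move=> _ _ [u [v [qu pv ->]]] [u' [v' [qu' pv' ->]]]; exists (u * u'), (v * v').
  by rewrite mulrACA; split=> //; exact: prime_mul.
- apply/qu/qsx; rewrite scalerA [u * s]mulrC; apply: (sP v) => //.
  by rewrite [v * u]mulrC -ruv.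
have Sk : S k by apply: Tx.
have keq (m : ideal R) : maximal_ideal m -> (forall r : R, k r -> m r) -> k = m.
  move=> [m1 _] km; apply: submodule_eq; apply/funext => r; apply/propext; split.
    exact: km.
  by have [_ /(_ m km)[/m1|]] := SMax _ Sk; last by apply.
have kq : k = q.
  apply: keq; first exact: SMax.
  move=> r kr; apply: contrapT => qr; apply: (kU r kr); exists r, 1.
  by rewrite mulr1; split=> //; case: pp.
apply: qNp; rewrite -kq; apply: keq; first exact: SMax.
move=> r kr; apply: contrapT => pr; apply: (kU r kr); exists 1, r.
by rewrite mul1r; split=> //; case: qp.
Qed.

(** The [r] for which [r *: x] splits form an ideal. A prime [q] containing it would be in [A] or
    [B], yet [torsion_localize] gives [s] outside [q] with [s *: x] torsion for [q] alone. *)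
Lemma torsion_split (A B : set (ideal R)) M (x : M) :
  A `|` B `<=` Max R -> torsion (A `|` B) M x ->
  exists y z, [/\ torsion A M y, torsion B M z & x = y + z].
Proof.
move=> ABM Tx.
have bP : is_submodule (fun r : R^o =>
    exists y z, [/\ torsion A M y, torsion B M z & r *: x = y + z]).
  split; first by exists 0, 0; rewrite scale0r addr0; split=> //; exact: submodule0.
  move=> a r r' [y [z [Ay Bz rx]]] [y' [z' [Ay' Bz' rx']]].
  exists (a *: y + y'), (a *: z + z'); split; [exact: submoduleS..|].
  by rewrite scalerDl -[a *: r]/(a * r) -scalerA rx rx' scalerDr addrACA.
suff [y [z]] : Submodule bP 1 by rewrite scale1r; exists y, z.
apply: ideal_unit => q qp bq.
have ABq : (A `|` B) q.
  apply: Tx => // v vx; apply: bq; exists 0, 0; rewrite vx addr0.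
  by split=> //; exact: submodule0.
have [s qs Ts] := torsion_localize ABM qp Tx ABq.
apply/qs/bq; case: ABq => [Aq|Bq].
  exists (s *: x), 0; rewrite addr0; split=> //; last exact: submodule0.
  by apply: torsion_mono Ts => _ ->.
exists 0, (s *: x); rewrite add0r; split=> //; first exact: submodule0.
by apply: torsion_mono Ts => _ ->.
Qed.

(** * Torsion at a maximal ideal as annihilation by its powers *)

Lemma ideal_exp_pow (m : set R) (a : R) n : m a -> ideal_exp m n (a ^+ n).
Proof.
move=> ma; elim: n => [//|n IHn]; exists 1%N, (fun=> a), (fun=> a ^+ n).
by split=> //; rewrite big_ord1 exprS.
Qed.

Lemma Gamma_of_generators (m : ideal R) M k (g : 'I_k -> R) (y : M) :
  (forall x : R, m x -> exists c : 'I_k -> R, x = \sum_(i < k) c i * g i) ->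
  (forall i, Gamma_set m M (g i *: y)) -> Gamma_set m M y.
Proof.
(* One factor in [m] turns [y] into a combination of the [g i *: y]; the remaining factors kill each
   of them. *)
move=> mg /choice[e eP]; exists (\max_(i < k) e i).+1 => _ [l [a [b [ab ->]]]].
rewrite scaler_suml big1 // => j _; have [/mg[c ->] bj] := ab j.
rewrite mulrC mulr_sumr scaler_suml big1 // => i _.
rewrite mulrCA -!scalerA eP ?scaler0 //.
exact: ideal_exp_le (leq_bigmax i) _ bj.
Qed.

(** Induction on the sum of exponents [e i] with [g i ^+ e i *: x = 0], for generators [g] of [m]:
    passing to [g i *: x] lowers [e i] by one. *)
Lemma Gamma_of_nilpotent (m : ideal R) M (x : M) :
  (forall a : R, m a -> exists n, a ^+ n *: x = 0) -> Gamma_set m M x.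
Proof.
move=> nil; have [k [g gP]] := noethR m.
have mg i : m (g i).
  apply/gP; exists (fun j => (i == j)%:R); rewrite (bigD1 i) //= eqxx mul1r big1 ?addr0 //.
  by move=> j; rewrite eq_sym => /negPf ->; rewrite mul0r.
have /choice[e eP] : forall i, exists n, g i ^+ n *: x = 0 by move=> i; exact: nil.
have [N] := ubnP (\sum_(i < k) e i)%N.
elim: N => // N IHN in e x nil eP *; rewrite ltnS => eN.
apply: (Gamma_of_generators (g := g)) => [a /gP //|i].
have [e0|e0] := posnP (e i).
  by have := eP i; rewrite e0 scale1r => ->; rewrite scaler0; exact: submodule0.
apply: (IHN (fun j => e j - (i == j))%N).
- move=> a /nil[n an]; exists n.
  by rewrite scalerA mulrC -scalerA an scaler0.
- move=> j; rewrite scalerA; case: eqP => [<-|_].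
    by rewrite subn1 -exprSr prednK.
  by rewrite subn0 mulrC -scalerA eP scaler0.
apply: leq_trans eN; rewrite (bigD1 i) //= [X in (_ < X)%N](bigD1 i) //= eqxx subn1.
rewrite -addSn prednK // leq_add2l; apply: leq_sum => j _; exact: leq_subr.
Qed.

(** If no power of some [a] in [m] killed a torsion [x], a prime containing the annihilator of [x]
    would avoid [a]; but torsion makes that prime [m]. *)
Lemma Gamma_torsion (m : ideal R) M (x : M) : maximal_ideal m ->
  Gamma_set m M x <-> torsion [set m] M x.
Proof.
move=> [m1 mmax]; split=> [[n nx] q qp qx|Tx].
  have mq (a : R) : m a -> q a.
    by move=> ma; apply: (@prime_exp _ q a n qp); apply: qx; apply/nx/ideal_exp_pow.
  apply: submodule_eq; apply/funext => r; apply/propext; split; last exact: mq.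
  by have [q1|] := mmax q mq; [case: qp.1 | apply].
apply: Gamma_of_nilpotent => a ma; apply: contrapT => na.
have [||r rx [n rn]|q [qp qx qU]] :=
    @prime_avoiding R (annihilator x) [set r | exists n, r = a ^+ n].
- by exists 0%N.
- by move=> _ _ [n ->] [k ->]; exists (n + k)%N; rewrite exprD.
- by apply: na; exists n; rewrite -rn.
have qm : q = m by apply: Tx.
by apply: (qU a); [rewrite qm | exists 1%N].
Qed.

End Noetherian.

(** * Linear maps, extension into injective modules, isomorphisms *)

Lemma linear_of (R : comNzRingType) (A B : lmodType R) (f : A -> B) :
  linear f -> exists g : {linear A -> B}, forall x, g x = f x.
Proof.
move=> fl; pose fL := GRing.isLinear.Build R A B _ f fl.
by exists (HB.pack_for {linear A -> B} f fL).
Qed.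

Lemma linear_sub (R : comNzRingType) (A B : lmodType R) (f g : {linear A -> B}) :
  exists h : {linear A -> B}, forall x, h x = f x - g x.
Proof.
by apply: linear_of => a x y; rewrite (linearP f) (linearP g) scalerBr opprD addrACA.
Qed.

(** Modulo its kernel [f] becomes injective, and [g] descends to that quotient. *)
Lemma injective_factor (R : comNzRingType) (A B E : lmodType R)
    (f : {linear A -> B}) (g : {linear A -> E}) : injective_module E ->
  (forall x, f x = 0 -> g x = 0) -> exists h : {linear B -> E}, forall x, h (f x) = g x.
Proof.
move=> injE fg.
have Kp : is_submodule (fun x => f x = 0).
  by split=> [|a x y fx fy]; rewrite ?linear0 // linearP fx fy scaler0 addr0.
pose K := Submodule Kp; pose Q := Defs.quot_type K.
have lift (C : lmodType R) (k : {linear A -> C}) : (forall x, f x = 0 -> k x = 0) ->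
    exists l : {linear Q -> C}, forall x, l (quot_proj K x) = k x.
  move=> fk; have lE x : k (repr (quot_proj K x)) = k x.
    apply/eqP; rewrite -subr_eq0 -linearB; apply/eqP/fk.
    by apply/(@quot_projP _ _ K); rewrite /quot_proj reprK.
  have [|l lP] := @linear_of R Q C (fun q => k (repr q)).
    move=> a p q; have [x <-] := quot_proj_surj p; have [y <-] := quot_proj_surj q.
    by rewrite -linearP !lE linearP.
  by exists l => x; rewrite lP lE.
have [f' f'P] := lift _ f (fun _ => id); have [g' g'P] := lift _ g fg.
have f'inj : injective f'.
  move=> p q; have [x <-] := quot_proj_surj p; have [y <-] := quot_proj_surj q.
  rewrite !f'P => /eqP; rewrite -subr_eq0 -linearB => /eqP fxy.
  exact/quot_projP.
have [h hP] := injE _ _ f' g' f'inj.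
by exists h => x; rewrite -f'P hP g'P.
Qed.

Lemma quot_projS (R : comNzRingType) (M : lmodType R) (N : submodule M) a x y :
  quot_proj N (a *: x + y) = a *: quot_proj N x + quot_proj N y.
Proof. exact: linearP. Qed.

Lemma val_submodS (R : comNzRingType) (M : lmodType R) (N : submodule M) a
  (x y : submod_type N) : val (a *: x + y) = a *: val x + val y.
Proof. by []. Qed.

Section Isomorphic.
Variable R : comNzRingType.
Implicit Types M N P : lmodType R.

Lemma isomorphic_inj_surj M N (f : {linear M -> N}) :
  (forall x, f x = 0 -> x = 0) -> (forall y, exists x, f x = y) -> isomorphic M N.
Proof.
move=> finj /choice[g gP]; exists f; exists g => // x.
by apply/eqP; rewrite -subr_eq0; apply/eqP/finj; rewrite linearB gP subrr.
Qed.

Lemma isomorphic_trans M N P : isomorphic M N -> isomorphic N P -> isomorphic M P.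
Proof. by move=> [f bf] [g bg]; exists (g \o f); exact: bij_comp. Qed.

Lemma isomorphic_sym M N : isomorphic M N -> isomorphic N M.
Proof.
move=> [f [g fK gK]].
have [|h hP] := @linear_of R N M g.
  by move=> a x y; rewrite -[LHS]fK -{1}[x]gK -{1}[y]gK -linearP !fK.
by exists h; exists f => x; rewrite hP.
Qed.

Lemma isomorphic_pair M M' N N' :
  isomorphic M M' -> isomorphic N N' -> isomorphic (M * N)%type (M' * N')%type.
Proof.
move=> [f [f' fK f'K]] [g [g' gK g'K]].
have [|h hP] := @linear_of R (M * N)%type (M' * N')%type (fun z => (f z.1, g z.2)).
  by move=> a x y; rewrite /= !linearP.
exists h; exists (fun z => (f' z.1, g' z.2)) => -[x y]; rewrite ?hP /= ?fK ?gK //.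
by rewrite f'K g'K.
Qed.

End Isomorphic.

(** * Derived functors of subfunctors of the identity, through representing cocycles *)

Section Subfunctor.
Variables (R : comNzRingType) (M : lmodType R).
Let E := standard_resolution M.

Lemma res_diffK n (x : res_obj E n) : res_diff E n.+1 (res_diff E n x) = 0.
Proof. by apply/res_exactS; exists x. Qed.

(** The coboundaries of the complex of submodules [G (E n)] in degree [n]. *)
Definition bounds (G : forall N : lmodType R, submodule N) n : res_obj E n -> Prop :=
  match n with
  | 0 => fun x => x = 0
  | n'.+1 => fun x => exists2 y, G _ y & res_diff E n' y = x
  end.

Lemma bounds_submodule G n : is_submodule (@bounds G n).
Proof.
case: n => [|n]; first by split=> // a x y -> ->; rewrite scaler0 addr0.
split; first by exists 0; [exact: submodule0 | rewrite linear0].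
move=> a x y [u Gu <-] [v Gv <-]; exists (a *: u + v); last by rewrite linearP.
exact: submoduleS.
Qed.

Lemma bounds_cycle G n (x : res_obj E n) : bounds G x -> res_diff E n x = 0.
Proof. by case: n x => [|n] x /= => [->|[y _ <-]]; [exact: linear0 | exact: res_diffK]. Qed.

Lemma bounds_mono (G G' : forall N : lmodType R, submodule N) n (x : res_obj E n) :
  (forall N x, G N x -> G' N x) -> bounds G x -> bounds G' x.
Proof. by case: n x => [//|n] x GG' [y Gy dy]; exists y => //; exact: GG'. Qed.

Section Represents.
Variable G : forall N : lmodType R, submodule N.
Hypothesis Gnat :
  forall (N N' : lmodType R) (f : {linear N -> N'}) x, G N x -> G N' (f x).
Variable n : nat.

Lemma bounds_sub (x : res_obj E n) : bounds G x -> G _ x.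
Proof. by case: n x => [|n'] x /= => [->|[y Gy <-]]; [exact: submodule0 | exact: Gnat]. Qed.

Let H := right_derived (subfunctor Gnat) n M.

(** Tying classes to elements of the resolution itself lets classes for different subfunctors share
    a representative. *)
Definition represents (h : H) (x : res_obj E n) : Prop :=
  exists z, quot_proj _ z = h /\ val (val z) = x.

Lemma represents_ex (h : H) : exists x, represents h x.
Proof. by have [z zh] := quot_proj_surj h; exists (val (val z)), z. Qed.

Lemma represents_cycle (h : H) x : represents h x -> G _ x /\ res_diff E n x = 0.
Proof.
move=> [z [_ <-]]; split; first exact/asboolP/(valP (val z)).
have /asboolP/(congr1 val) := valP z.
by [].
Qed.

Lemma represents_class (x : res_obj E n) :
  G _ x -> res_diff E n x = 0 -> exists h, represents h x.
Proof.
move=> Gx dx.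
pose y : submod_type (G (res_obj E n)) := Sub x (introT (asboolP _) Gx).
have yP : submodule_pred (cocycle (fun n => fmap (subfunctor Gnat) (res_diff E n)) n) y.
  by apply/asboolP/val_inj.
by exists (quot_proj _ (Sub y yP)), (Sub y yP).
Qed.

Lemma representsS a h h' x x' : represents h x -> represents h' x' ->
  represents (a *: h + h') (a *: x + x').
Proof.
move=> [z [zh zx]] [z' [zh' zx']]; exists (a *: z + z'); split.
  by rewrite quot_projS zh zh'.
by rewrite -zx -zx' val_submodS.
Qed.

Lemma represents_eq0 h x : represents h x -> h = 0 <-> bounds G x.
Proof.
move=> [z [<- <-]]; rewrite -(raddf0 (quot_proj _)).
apply: iff_trans; first exact: quot_projP.
rewrite subr0 {h x} /=; case: n z => [|n'] z /=.
  by split=> [->|e] //; apply: val_inj.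
split=> [[y <-]|[y Gy dy]]; first by exists (val y) => //; exact/asboolP/(valP y).
by exists (Sub y (introT (asboolP _) Gy)); apply: val_inj.
Qed.

End Represents.

Section Compare.
Variables G G' : forall N : lmodType R, submodule N.
Hypothesis Gnat :
  forall (N N' : lmodType R) (f : {linear N -> N'}) x, G N x -> G N' (f x).
Hypothesis G'nat :
  forall (N N' : lmodType R) (f : {linear N -> N'}) x, G' N x -> G' N' (f x).
Hypothesis GG' : forall (N : lmodType R) (x : N), G N x -> G' N x.
Variable n : nat.
Let H := right_derived (subfunctor Gnat) n M.
Let H' := right_derived (subfunctor G'nat) n M.

Lemma right_derived_incl : exists f : {linear H -> H'},
  forall h x, represents h x -> represents (f h) x.
Proof.
have /choice[r rP] : forall h : H, exists x, represents h x by exact: represents_ex.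
have /choice[f fP] : forall h : H, exists h' : H', represents h' (r h).
  move=> h; have [Gr dr] := represents_cycle (rP h).
  by apply: represents_class => //; exact: GG'.
have fE h x h' : represents h x -> represents h' x -> f h = h'.
  move=> hx h'x; apply/eqP; rewrite -subr_eq0 addrC -scaleN1r; apply/eqP.
  apply/(represents_eq0 (representsS (-1) h'x (fP h))).
  apply: bounds_mono GG' _.
  by apply/(represents_eq0 (representsS (-1) hx (rP h))); rewrite scaleN1r addNr.
have fR h x : represents h x -> represents (f h) x.
  move=> hx; have [Gx dx] := represents_cycle hx.
  have [h' h'x] : exists h' : H', represents h' x.
    by apply: represents_class => //; exact: GG'.
  by rewrite (fE _ _ _ hx h'x).
have [|g gE] := @linear_of R H H' f; last by exists g => h x; rewrite gE; exact: fR.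
move=> a h k; apply: fE (representsS a (rP h) (rP k)) _.
exact: representsS.
Qed.

(** The two hypotheses make the map of [right_derived_incl] surjective and injective,
    respectively. *)
Lemma right_derived_isomorphic :
  (forall x : res_obj E n, G' _ x -> res_diff E n x = 0 ->
    exists2 y, bounds G' y & G _ (x - y)) ->
  (forall x : res_obj E n, G _ x -> bounds G' x -> bounds G x) -> isomorphic H H'.
Proof.
move=> surj inj; have [f fP] := right_derived_incl.
apply: (isomorphic_inj_surj (f := f)).
  move=> h; have [x hx] := represents_ex h.
  have [Gx _] := represents_cycle hx.
  by move/(represents_eq0 (fP _ _ hx))/inj => bx; apply/(represents_eq0 hx)/bx.
move=> h'; have [x h'x] := represents_ex h'.
have [G'x dx] := represents_cycle h'x.
have [y by_ Gxy] := surj x G'x dx.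
have [|h hxy] := @represents_class G Gnat n _ Gxy.
  by rewrite linearB dx (bounds_cycle by_) subrr.
exists h; apply/eqP; rewrite -subr_eq0 addrC -scaleN1r; apply/eqP.
apply/(represents_eq0 (representsS (-1) h'x (fP _ _ hxy))).
rewrite scaleN1r addrA addNr add0r -sub0r.
apply: (submoduleB (N := Submodule (bounds_submodule G' n))) => //.
exact: submodule0.
Qed.

End Compare.
End Subfunctor.

(** * The null-homotopy that reduces [W]-torsion to [S]-torsion *)

Section Homotopy.
Variables (R : comNzRingType) (noethR : noetherian R) (M : lmodType R).
Variables W S : set (ideal R).
Hypothesis SW : S `<=` W.
Let E := standard_resolution M.

Let torsion_cohomology n := forall x : res_obj E n, torsion W _ x -> res_diff E n x = 0 ->
  forall q : ideal R, prime_ideal q -> ~ S q ->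
  exists2 u : R, ~ q u & bounds (torsion W) (u *: x).

(** [b] plays the part of [d s] for a null-homotopy [s], defined in degree [n], of
    the complex of [W]-torsion modulo [S]-torsion submodules. *)
Let contraction n (b : {linear res_obj E n -> res_obj E n}) :=
  (forall x, bounds (torsion W) (b x)) /\
  forall y, bounds (torsion W) y -> torsion S _ (b y - y).

Let bounds_torsion n (x : res_obj E n) : bounds (torsion W) x -> torsion W _ x.
Proof. by apply: bounds_sub => N N' f y; exact: torsion_natural. Qed.

(** For a prime [q] outside [S], some [u] outside [q] kills the differential of [x], and some [v]
    outside [q] makes [v *: (u *: x)] a coboundary, on which [b] is the identity up to
    [S]-torsion. *)
Lemma contraction_torsion n (b : {linear res_obj E n -> res_obj E n}) (x : res_obj E n) :
  torsion_cohomology n -> contraction b -> torsion W _ x -> torsion S _ (res_diff E n x) -> torsion S _ (x - b x).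
Proof.
move=> tors [bB bS] Wx Sdx; apply: torsion_local => q qp qS.
have /torsionP/(_ q qp qS)[u qu udx] := Sdx.
have [||v qv vux] := tors (u *: x) _ _ q qp qS.
- exact: submoduleZ.
- by rewrite linearZ.
exists (v * u); first exact: prime_mul.
rewrite scalerBr -linearZ -opprB -sub0r -scalerA.
by apply: submoduleB; [exact: submodule0 | exact: bS].
Qed.

Lemma contractionS n (b : {linear res_obj E n -> res_obj E n}) :
  torsion_cohomology n -> contraction b ->
  exists b' : {linear res_obj E n.+1 -> res_obj E n.+1}, contraction b'.
Proof.
move=> tors cb; have [bB bS] := cb.
have [w [wW wE]] := torsion_retraction noethR W (@res_injective _ _ E n).
have [p [pS pE]] := torsion_retraction noethR S (@res_injective _ _ E n).
have [p' [p'S p'E]] := torsion_retraction noethR S (@res_injective _ _ E n.+1).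
pose TW := submod_type (torsion W (res_obj E n)).
(* The kernel of [r] is the [S]-torsion, so [r] stands for the quotient by it; subtracting [p \o c]
   in [g] has the same effect in degree [n]. *)
have [r rE] := linear_sub (idfun : {linear _ -> _}) p'.
have [c cE] := linear_sub (val : {linear TW -> _}) (b \o val).
have [g gE] := linear_sub c (p \o c).
pose f : {linear TW -> res_obj E n.+1} := r \o (res_diff E n \o val).
(* By [contraction_torsion], [x - b x] modulo [S]-torsion depends only on the differential of [x]
   modulo [S]-torsion. *)
have [|h hE] := @injective_factor R TW _ _ f g (@res_injective _ _ E n).
  move=> x; rewrite /f gE /= rE /= => /eqP; rewrite subr_eq0 => /eqP dx.
  rewrite pE ?subrr // cE; apply: contraction_torsion => //; first exact/asboolP/(valP x).
  by rewrite dx.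
(* The homotopy is [w \o (h \o r)]; [w] forces its values into the [W]-torsion. *)
pose b' : {linear res_obj E n.+1 -> res_obj E n.+1} := res_diff E n \o (w \o (h \o r)).
exists b'; split=> [x|_ [x Wx <-]].
  by exists (w (h (r x))).
have := hE (Sub x (introT (asboolP _) Wx)); rewrite /f gE /= cE /= => hx.
rewrite /b' /= hx.
have Wbx : torsion W _ (x - b x) by apply: submoduleB => //; exact/bounds_torsion/bB.
rewrite wE; last by apply: submoduleB => //; apply: torsion_mono SW _.
rewrite linearB linearB (bounds_cycle (bB x)) subr0 addrC addrA addNr sub0r.
rewrite -linearN; apply: torsion_natural; rewrite -sub0r.
by apply: submoduleB => //; exact: submodule0.
Qed.

Lemma contraction_ex n : (forall i, (i < n)%N -> torsion_cohomology i) ->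
  exists b : {linear res_obj E n -> res_obj E n}, contraction b.
Proof.
elim: n => [_|n IHn tors]; last first.
  have [|b cb] := IHn; first by move=> i ni; apply: tors; exact: ltnW.
  by apply: contractionS cb; exact: tors.
(* In degree 0 the only coboundary is 0, so the zero map is a contraction. *)
have [|b bE] := @linear_of R (res_obj E 0) (res_obj E 0) (fun=> 0).
  by move=> a x y; rewrite scaler0 addr0.
exists b; split=> [x|y ->]; first exact: bE.
by rewrite bE subrr; exact: submodule0.
Qed.

(** A [W]-torsion cocycle [x] is cohomologous to the [S]-torsion [x - b x]. If the differential of a
    [W]-torsion [y] is [S]-torsion, [y - b y], with [b] one degree lower, is [S]-torsion with the
    same differential. *)
Lemma right_derived_torsion n : (forall i, (i <= n)%N -> torsion_cohomology i) ->
  isomorphic (right_derived (subfunctor (@torsion_natural R S)) n M)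
             (right_derived (subfunctor (@torsion_natural R W)) n M).
Proof.
move=> tors; apply: right_derived_isomorphic.
- by move=> N x; exact: torsion_mono SW.
- move=> x Wx dx; have [b cb] := contraction_ex (fun i ni => tors i (ltnW ni)).
  exists (b x); first exact: cb.1.
  apply: contraction_torsion => //; first exact: tors.
  by rewrite dx; exact: submodule0.
case: n tors => [//|n] tors x Sx [y Wy dy]; rewrite -{x}dy in Sx *.
have [b cb] := @contraction_ex n (fun i ni => tors i (leqW (ltnW ni))).
exists (y - b y); first by apply: contraction_torsion => //; apply: tors.
by rewrite linearB (bounds_cycle (cb.1 y)) subr0.
Qed.

End Homotopy.

(** * Splitting over disjoint sets of maximal ideals *)

Section DirectSum.
Variables (R : comNzRingType) (noethR : noetherian R) (M : lmodType R).
Variables A B : set (ideal R).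
Hypotheses (ABM : A `|` B `<=` Max R) (AB0 : A `&` B `<=` set0).

Lemma torsion_split_uniq (N : lmodType R) (y y' z z' : N) :
  torsion A N y -> torsion A N y' -> torsion B N z -> torsion B N z' ->
  y + z = y' + z' -> y = y' /\ z = z'.
Proof.
move=> Ay Ay' Bz Bz' /eqP; rewrite -subr_eq0 opprD addrACA addr_eq0 => /eqP yz.
have y0 : y - y' = 0.
  apply: torsion_disjoint AB0 _ _; first exact: submoduleB.
  by rewrite yz -sub0r; apply: submoduleB; [exact: submodule0 | exact: submoduleB].
split; apply/eqP; rewrite -subr_eq0; first exact/eqP.
by rewrite -oppr_eq0 -yz; apply/eqP.
Qed.

Lemma bounds_split n (y z : res_obj (standard_resolution M) n) :
  torsion A _ y -> torsion B _ z -> bounds (torsion (A `|` B)) (y + z) ->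
  bounds (torsion A) y /\ bounds (torsion B) z.
Proof.
case: n y z => [|n] y z Ay Bz.
  by rewrite /= -[X in _ = X]addr0; apply: torsion_split_uniq => //; exact: submodule0.
move=> [x /(torsion_split noethR ABM)[x1 [x2 [Ax1 Bx2 ->]]]]; rewrite linearD => dx.
have [|||| <- <-] := torsion_split_uniq _ _ _ _ dx => //; try exact: torsion_natural.
by split; [exists x1 | exists x2].
Qed.

Let H S n := right_derived (subfunctor (@torsion_natural R S)) n M.

(** Injectivity comes from [bounds_split]. For surjectivity, the two parts of a cocycle are cocycles
    because 0 splits uniquely. *)
Lemma right_derived_torsion_setU n : isomorphic (H A n * H B n)%type (H (A `|` B) n).
Proof.
have [|f fP] := @right_derived_incl R M _ _ (@torsion_natural R A)
    (@torsion_natural R (A `|` B)) _ n.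
  by move=> N x; apply: torsion_mono => p; left.
have [|g gP] := @right_derived_incl R M _ _ (@torsion_natural R B)
    (@torsion_natural R (A `|` B)) _ n.
  by move=> N x; apply: torsion_mono => p; right.
have [|k kP] := @linear_of R (H A n * H B n)%type (H (A `|` B) n)
    (fun z => f z.1 + g z.2).
  by move=> a x y; rewrite !linearP scalerDr addrACA.
have reprD h h' x x' (hx : represents h x) (h'x' : represents h' x') :
    represents (f h + g h') (x + x').
  by have := representsS 1 (fP _ _ hx) (gP _ _ h'x'); rewrite !scale1r.
apply: (isomorphic_inj_surj (f := k)) => [[h h']|h].
  have [y hy] := represents_ex h; have [z h'z] := represents_ex h'.
  have [Ay _] := represents_cycle hy; have [Bz _] := represents_cycle h'z.
  rewrite kP /= => /(represents_eq0 (reprD _ _ _ _ hy h'z)) /(bounds_split Ay Bz)[yb zb].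
  by congr (_, _); [exact/(represents_eq0 hy)|exact/(represents_eq0 h'z)].
have [x hx] := represents_ex h.
have [/(torsion_split noethR ABM)[y [z [Ay Bz xyz]]]] := represents_cycle hx.
rewrite xyz linearD -[X in _ = X]addr0 => dyz.
have [||||dy dz] := torsion_split_uniq _ _ _ _ dyz; try exact: torsion_natural;
  try exact: submodule0.
have [hy hyP] := represents_class (@torsion_natural R A) Ay dy.
have [hz hzP] := represents_class (@torsion_natural R B) Bz dz.
exists (hy, hz); rewrite kP; apply/eqP; rewrite -subr_eq0 addrC -scaleN1r; apply/eqP.
apply/(represents_eq0 (representsS (-1) hx (reprD _ _ _ _ hyP hzP))).
by rewrite scaleN1r xyz addNr; exact: (submodule0 (Submodule (bounds_submodule M _ n))).
Qed.

End DirectSum.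

(** * Supports, and assembly of the direct sum decomposition *)

Lemma SuppP (R : comNzRingType) (M : lmodType R) (q : ideal R) : Supp M q <->
  prime_ideal q /\ exists x : M, forall v : R, v *: x = 0 -> q v.
Proof.
split=> [[qp [x [s [qs nx]]]]|[qp [x qx]]]; split=> //.
  exists x => v vx; apply: contrapT => qv; apply: nx; exists v; split=> //.
  by rewrite scale1r scaler0 subr0.
exists x, 1; split; first exact: qp.1.
by move=> [v [qv]]; rewrite scale1r scaler0 subr0 => /qx.
Qed.

Lemma Gamma_pair_torsion (R : comNzRingType) (I J : ideal R) (M : lmodType R) (x : M) :
  Gamma_pair_set I J M x <-> torsion (W I J) M x.
Proof.
split=> Wx q; first by move=> qp qx; apply: Wx; apply/Supp_cyclicP.
by move=> /Supp_cyclicP[qp qx]; exact: Wx.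
Qed.

Lemma right_derived_eq (R : comNzRingType) (M : lmodType R)
    (G G' : forall N : lmodType R, submodule N)
    (Gnat : forall (N N' : lmodType R) (f : {linear N -> N'}) x, G N x -> G N' (f x))
    (G'nat : forall (N N' : lmodType R) (f : {linear N -> N'}) x, G' N x -> G' N' (f x))
    n : (forall (N : lmodType R) (x : N), G N x <-> G' N x) ->
  isomorphic (right_derived (subfunctor Gnat) n M) (right_derived (subfunctor G'nat) n M).
Proof.
move=> GG'; apply: right_derived_isomorphic.
- by move=> N x /GG'.
- move=> x G'x _; exists 0; first exact: (submodule0 (Submodule (bounds_submodule M _ n))).
  by rewrite subr0; apply/GG'.
by move=> x _; apply: bounds_mono => N y /GG'.
Qed.

Lemma direct_sum_torsion (R : comNzRingType) (noethR : noetherian R) (M : lmodType R)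
    (n k : nat) (m : 'I_k -> ideal R) (s : seq 'I_k) :
  injective m -> (forall j, maximal_ideal (m j)) -> uniq s ->
  isomorphic
    (right_derived (subfunctor (@torsion_natural R [set m j | j in [set` s]])) n M)
    (direct_sum [seq local_cohomology (m j) n M | j <- s]).
Proof.
move=> minj mmax; elim: s => [_|j s IHs /= /andP[js us]].
  have [|f _] := @linear_of R (right_derived (subfunctor (@torsion_natural R
      [set m j | j in [set` [::]]])) n M) (direct_sum [::]) (fun=> 0).
    by move=> a x y; rewrite scaler0 addr0.
  apply: (isomorphic_inj_surj (f := f)) => [h _|y]; last by exists 0; apply/rowP => -[].
  have [x hx] := represents_ex h; apply/(represents_eq0 hx).
  have [Tx _] := represents_cycle hx.
  suff -> : x = 0 by exact: (submodule0 (Submodule (bounds_submodule M _ n))).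
  by apply: torsion0; apply: torsion_mono Tx => p [].
have -> : [set m i | i in [set` j :: s]] = [set m j] `|` [set m i | i in [set` s]].
  apply/seteqP; split=> [_ [i /= + <-]|p].
    by rewrite inE => /predU1P[->|si]; [left | right; exists i].
  move=> [->|[i si <-]]; first by exists j => //=; rewrite mem_head.
  by exists i => //=; rewrite inE si orbT.
apply: isomorphic_trans; last first.
  apply: isomorphic_pair; last exact: IHs.
  apply: (@right_derived_eq R M _ _ (@torsion_natural R [set m j])) => N x.
  by apply: iff_sym; exact: Gamma_torsion.
apply: isomorphic_sym; apply: right_derived_torsion_setU => //.
  by move=> _ [->|[i _ <-]]; exact: mmax.
by move=> _ [-> [i /= si /minj ij]]; move: js; rewrite -ij si.
Qed.

Theorem corollary3p7 (R : comNzRingType) (noethR : noetherian R)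
    (I J : ideal R) (M : lmodType R) (t : int)
    (suppH : forall i : nat, i%:Z < t ->
       finite_set (Supp (local_cohomology_pair I J i M)) /\
       Supp (local_cohomology_pair I J i M) `<=` Max R) :
  exists (k : nat) (m : 'I_k -> ideal R),
    (forall j : 'I_k, maximal_ideal (m j) /\ W I J (m j)) /\
    forall i : nat, i%:Z < t ->
      isomorphic (local_cohomology_pair I J i M)
        (direct_sum [seq local_cohomology (m j) i M | j <- enum 'I_k]).
Proof.
pose S := \bigcup_(i in [set i : nat | i%:Z < t]) Supp (local_cohomology_pair I J i M).
have Sfin : finite_set S.
  apply: bigcup_finite => [|i /suppH[]//].
  apply: sub_finite_set (finite_II `|t|%N) => i /= it.
  by rewrite -ltz_nat gez0_abs // ltW // (le_lt_trans _ it).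
have SMax : S `<=` Max R by move=> p [i /suppH[_ +]]; apply.
(* [representsS] concerns sums [a *: h + h']; taking [a = v - 1] and [h' = h] gives [v *: h]. *)
have reprZ i (h : local_cohomology_pair I J i M) x (v : R) :
    represents h x -> represents (v *: h) (v *: x).
  by move=> hx; have := representsS (v - 1) hx hx; rewrite !scalerBl !scale1r !subrK.
(* If the annihilator of a class lies in [p], so does that of a representing cocycle, which is
   torsion for [W I J]. *)
have SW : S `<=` W I J.
  move=> p [i _ /SuppP[pp [h ph]]]; have [x hx] := represents_ex h.
  have [Gx _] := represents_cycle hx; apply: Gx; apply/Supp_cyclicP; split=> // v vx.
  apply/ph/(represents_eq0 (reprZ _ _ _ v hx)); rewrite vx.
  exact: (submodule0 (Submodule (bounds_submodule M _ i))).
(* The ideals [m j] enumerate [S] without repetition, as [m] inverts the bijection [f]. *)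
have [k /card_set_bijP[f [fk finj fsurj]]] := Sfin.
have /choice[m mP] : forall j : 'I_k, exists p, S p /\ f p = j.
  by move=> j; have [p Sp fp] := fsurj j (ltn_ord j); exists p.
have minj : injective m by move=> j j' mj; apply: val_inj; rewrite /= -!(mP _).2 mj.
have mS : [set m j | j in [set` enum 'I_k]] = S.
  apply/seteqP; split=> [_ [j _ <-]|p Sp]; first exact: (mP j).1.
  exists (Ordinal (fk p Sp)); first by rewrite /= mem_enum.
  by apply: finj; rewrite ?(mP _).2 //; apply/mem_set => //; exact: (mP _).1.
exists k, m; split=> [j|i it]; first by split; [apply: SMax | apply: SW]; exact: (mP j).1.
apply: isomorphic_trans (@direct_sum_torsion R noethR M i k m _ minj _ (enum_uniq _));
  last by move=> j; exact/SMax/(mP j).1.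
rewrite mS; apply: isomorphic_trans.
  apply: (right_derived_eq M _ (@torsion_natural R (W I J)) i).
  exact: Gamma_pair_torsion.
apply: isomorphic_sym; apply: right_derived_torsion => // n ni x Wx dx q qp qS.
(* If no [u *: x] with [u] outside [q] were a coboundary, the annihilator of the class [h] would lie
   in [q], putting [q] in the support in degree [n] and so in [S]. *)
have [|h hx] := @represents_class R M _ (@Gamma_pair_natural R I J) n x _ dx.
  exact/Gamma_pair_torsion.
apply: contrapT => nu; apply: qS; exists n; first by rewrite /= (le_lt_trans _ it).
apply/SuppP; split=> //; exists h => v vh; apply: contrapT => qv; apply: nu; exists v => //.
have /(represents_eq0 (reprZ _ _ _ v hx)) := vh.
by apply: bounds_mono => N y /Gamma_pair_torsion.
Qed.
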